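(* Let $N\ge1$, let $x_j=\cos\left(\frac{j\pi}{N}\right)$ for $j=0,\ldots,N$, let $s_i=[x_i,x_{i-1}]$ for $i=1,\ldots,N$, and let $\widetilde D_N\in\mathbb R^{N\times N}$ be defined by $[\widetilde D_N]_{ik}=\int_{s_i}T_k'(x)\,dx$, $i,k=1,\ldots,N$. Let \[ [\widetilde S_N]_{ik}=\sin\left(\frac{(2i-1)k\pi}{2N}\right),\quad i,k=1,\ldots,N,\qquad \widetilde\Sigma_N=\operatorname{diag}\left(2\sin\left(\frac{k\pi}{2N}\right)\right)_{k=1}^N . \] Then \[ \widetilde D_N=\widetilde S_N\widetilde\Sigma_N . \] Moreover, \[ \widetilde S_N^\top\widetilde S_N=\operatorname{diag}\left(\frac N2,\ldots,\frac N2,N\right), \] where the first $N-1$ diagonal entries equal $\frac N2$ and the last one equals $N$.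
   Context: $T_k$ is the Chebyshev polynomial of the first kind of degree $k$, $T_k(\cos\theta)=\cos(k\theta)$. *)

(* Defs.v *)
From HB Require Import structures.
From mathcomp Require Import all_boot all_order all_algebra.
From mathcomp Require Import ring lra.
From mathcomp Require Import all_classical all_reals all_analysis.

Set Implicit Arguments.
Unset Strict Implicit.
Unset Printing Implicit Defensive.

Import Order.TTheory GRing.Theory Num.Theory.
Import numFieldNormedType.Exports.

Local Open Scope classical_set_scope.
Local Open Scope ring_scope.

Section Chebyshev.
Variable R : realType.
Implicit Types (k : nat) (p q : {poly R}).

(* The degree-k polynomial p with p (cos t) = cos (k t) for all t. The default
   value 0 of xget is never taken, and there is no real choice: see
   chebyshev_size, chebyshev_cos and chebyshev_unique. *)
Definition chebyshev k : {poly R} :=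
  xget 0 [set p : {poly R} |
    size p = k.+1 /\ forall t : R, p.[cos t] = cos (k%:R * t)].

Fixpoint chebyshev_rec k : {poly R} :=
  match k with
  | 0 => 1
  | 1 => 'X
  | (k'.+1 as k1).+1 => 2%:P * 'X * chebyshev_rec k1 - chebyshev_rec k'
  end.

Lemma chebyshev_recSS k :
  chebyshev_rec k.+2 = 2%:P * 'X * chebyshev_rec k.+1 - chebyshev_rec k.
Proof. by []. Qed.

Lemma chebyshev_rec_size k : size (chebyshev_rec k) = k.+1.
Proof.
suff: size (chebyshev_rec k) = k.+1 /\ size (chebyshev_rec k.+1) = k.+2 by case.
elim: k => [|k [IH0 IH1]]; first by rewrite /= size_poly1 size_polyX.
split=> //; rewrite chebyshev_recSS.
have nz : chebyshev_rec k.+1 != 0 by rewrite -size_poly_eq0 IH1.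
have sz : size (2%:P * 'X * chebyshev_rec k.+1) = k.+3.
  by rewrite -mulrA mul_polyC size_scale ?pnatr_eq0// mulrC size_mulX ?IH1.
by rewrite size_polyDl ?sz// size_polyN IH0.
Qed.

Lemma chebyshev_rec_cos k t : (chebyshev_rec k).[cos t] = cos (k%:R * t).
Proof.
suff: (chebyshev_rec k).[cos t] = cos (k%:R * t) /\
      (chebyshev_rec k.+1).[cos t] = cos (k.+1%:R * t) by case.
elim: k => [|k [IH0 IH1]].
  by rewrite /= hornerX hornerC mul0r cos0 mul1r.
split=> //; rewrite chebyshev_recSS !hornerE IH0 IH1.
have -> : k%:R * t = k.+1%:R * t - t by rewrite -natr1; ring.
have -> : k.+2%:R * t = k.+1%:R * t + t by rewrite -(natr1 k.+1); ring.
by rewrite cosB cosD; ring.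
Qed.

Lemma chebyshevP k : size (chebyshev k) = k.+1 /\
  forall t : R, (chebyshev k).[cos t] = cos (k%:R * t).
Proof.
apply: (@xgetPex _ 0 [set p : {poly R} |
    size p = k.+1 /\ forall t : R, p.[cos t] = cos (k%:R * t)]).
exists (chebyshev_rec k); split; first exact: chebyshev_rec_size.
by move=> t; exact: chebyshev_rec_cos.
Qed.

Lemma chebyshev_size k : size (chebyshev k) = k.+1.
Proof. by have [] := chebyshevP k. Qed.

Lemma chebyshev_cos k (t : R) : (chebyshev k).[cos t] = cos (k%:R * t).
Proof. by have [_] := chebyshevP k. Qed.

Lemma poly_eq_on_cos p q : (forall t : R, p.[cos t] = q.[cos t]) -> p = q.
Proof.
move=> pq; apply/eqP; rewrite -subr_eq0; apply/negP => /negP nz.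
set r := p - q in nz.
have := @max_poly_roots _ r [seq (i.+1%:R : R)^-1 | i <- iota 0 (size r)] nz.
rewrite size_map size_iota ltnn => /(_ _ _) H; suff: false by [].
apply: H; last first.
  rewrite map_inj_uniq ?iota_uniq// => i j /invr_inj/eqP.
  by rewrite eqr_nat => /eqP[].
apply/allP => _ /mapP[i _ ->]; rewrite /root /r hornerD hornerN subr_eq0.
have i01 : (i.+1%:R : R)^-1 \in `[(-1), 1].
  rewrite in_itv /=; apply/andP; split.
    by rewrite (le_trans (lerN10 R))// invr_ge0.
  by rewrite invf_le1 ?ler1n ?ltr0n.
by rewrite -(acosK i01) pq.
Qed.

Lemma chebyshev_unique k p :
  (forall t : R, p.[cos t] = cos (k%:R * t)) -> p = chebyshev k.
Proof. by move=> pk; apply: poly_eq_on_cos => t; rewrite pk chebyshev_cos. Qed.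

Lemma chebyshevE k : chebyshev k = chebyshev_rec k.
Proof. by apply/esym/chebyshev_unique => t; exact: chebyshev_rec_cos. Qed.

End Chebyshev.

Section Matrices.
Variables (R : realType) (N : nat).

Definition node (j : nat) : R := cos (j%:R * pi / N%:R).

(* The nodes decrease with j: the segment s_i has left endpoint x_i. It is
   meaningful for 1 <= i <= N only. *)
Definition segment (i : nat) : set R := `[node i, node i.-1]%classic.

(* Row and column indices range over 0, .., N-1: entry (i, k) of each matrix
   below is the entry of index (i+1, k+1) in 1-based numbering. *)
Definition Dmx : 'M[R]_N :=
  \matrix_(i < N, k < N)
    (\int[lebesgue_measure]_(x in segment i.+1) ((chebyshev R k.+1)^`()).[x]).

Definition Smx : 'M[R]_N :=
  \matrix_(i < N, k < N)
    sin ((2 * i.+1%:R - 1) * k.+1%:R * pi / (2 * N%:R)).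

Definition Sigmamx : 'M[R]_N :=
  diag_mx (\row_(k < N) (2 * sin (k.+1%:R * pi / (2 * N%:R)))).

End Matrices.

(* Main.v *)
(** With [a = (2i-1)k pi/2N] and [b = k pi/2N], the integral of [T_k'] over [s_i]
    is [cos (a - b) - cos (a + b) = 2 sin a sin b]. The Gram matrix entries reduce,
    by the same product formula, to the sums of [cos ((2i-1) m pi/2N)] over [i] for
    [m = |k - l|] and [m = k + l]; multiplied by [2 sin (m pi/2N)] these telescope
    to [sin (m pi) = 0], so they vanish unless [m = 0] or [m = 2N]. *)
Require Import Defs.
From mathcomp Require Import all_boot all_order all_algebra.
From mathcomp Require Import ring zify.
From mathcomp Require Import all_classical all_reals all_analysis.

Import Order.TTheory GRing.Theory Num.Theory.
Import numFieldNormedType.Exports.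

Local Open Scope ring_scope.

Lemma Rintegral_deriv (R : realType) (p : {poly R}) (a b : R) : a < b ->
  \int[lebesgue_measure]_(x in `[a, b]%classic) (p^`()).[x] = p.[b] - p.[a].
Proof.
move=> ab; rewrite /Rintegral (@continuous_FTC2 _ _ (horner p)) //.
- by apply: continuous_subspaceT => x; exact: continuous_horner.
- split=> [x _||].
  + exact: derivable_horner.
  + by apply: cvg_at_right_filter; exact: continuous_horner.
  + by apply: cvg_at_left_filter; exact: continuous_horner.
- by move=> x _; rewrite derivE.
Qed.

(** This makes each [segment] nondegenerate, as [Rintegral_deriv] requires; [cos] decreases strictly
    on [[0, pi]]. *)
Lemma node_decreasing (R : realType) (N i : nat) : (i < N)%N ->
  node R N i.+1 < node R N i.
Proof.
move=> iN; have N0 : 0 < N%:R :> R by rewrite ltr0n; lia.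
have jpi j : (j <= N)%N -> j%:R * pi / N%:R \in `[0, pi : R].
  move=> jN; rewrite in_itv /= divr_ge0 ?mulr_ge0 ?pi_ge0 ?ler0n //=.
  by rewrite ler_pdivrMr // mulrC ler_wpM2l ?pi_ge0 // ler_nat.
rewrite /node ltr_cos ?jpi //; last exact: ltnW.
by rewrite ltr_pM2r ?invr_gt0 // ltr_pM2r ?pi_gt0 // ltr_nat.
Qed.

Lemma sin_natpi (R : realType) (m : nat) : sin (m%:R * pi) = 0 :> R.
Proof.
by rewrite mulr_natl -[pi *+ m]add0r (alternatingn (@sinDpi R)) sin0 mulr0.
Qed.

Lemma cos_oddpi (R : realType) (i : nat) :
  cos ((2 * i.+1%:R - 1) * pi) = -1 :> R.
Proof.
have -> : (2 * i.+1%:R - 1) * pi = pi + pi *+ 2 *+ i :> R.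
  by rewrite -mulrnA -[pi *+ (2 * i)]mulr_natr natrM; ring.
by rewrite (periodicn (@cosD2pi R)) cospi.
Qed.

Lemma mul_sin_sin (R : realType) (x y : R) :
  sin x * sin y = (cos (x - y) - cos (x + y)) / 2.
Proof. by rewrite cosB cosD; field. Qed.

(** Each summand times [2 * sin t] is [sin (2(i+1)t) - sin (2it)]. Keeping the factor instead of
    dividing by it covers the zeros of [sin t] too. *)
Lemma sum_cos_odd (R : realType) (n : nat) (t : R) :
  (\sum_(i < n) cos ((2 * i.+1%:R - 1) * t)) * (2 * sin t) =
  sin (2 * n%:R * t).
Proof.
elim: n => [|n IH]; first by rewrite big_ord0 mulr0 !mul0r sin0.
rewrite big_ord_recr mulrDl IH /=.
have -> : 2 * n%:R * t = (2 * n.+1%:R - 1) * t - t by ring.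
have -> : 2 * n.+1%:R * t = (2 * n.+1%:R - 1) * t + t by ring.
by rewrite sinB sinD; ring.
Qed.

Lemma sum_cos_odd_eq0 (R : realType) (N m : nat) : (0 < m < 2 * N)%N ->
  \sum_(i < N) cos ((2 * i.+1%:R - 1) * (m%:R * pi / (2 * N%:R))) = 0 :> R.
Proof.
move=> /andP[m0 mN].
have N0 : 0 < N%:R :> R by rewrite ltr0n; lia.
have := sum_cos_odd R N (m%:R * pi / (2 * N%:R)).
have -> : 2 * N%:R * (m%:R * pi / (2 * N%:R)) = m%:R * pi :> R.
  by field; rewrite gt_eqF.
rewrite sin_natpi => /eqP; rewrite mulf_eq0 => /orP[/eqP //|].
(* The bounds on [m] place [m pi/2N] strictly between 0 and [pi], so the sine factor is positive and
   the sum must vanish. *)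
rewrite gt_eqF // mulr_gt0 // sin_gt0_pi //.
rewrite divr_gt0 ?mulr_gt0 ?pi_gt0 ?(ltr0n _ m) //=.
rewrite ltr_pdivrMr ?mulr_gt0 // mulrC ltr_pM2l ?pi_gt0 //.
by rewrite -natrM ltr_nat.
Qed.

(** The order [l <= k] keeps the natural-number difference [k - l] from truncating; the other case
    follows by symmetry. *)
Lemma gram_sin_odd (R : realType) (N k l : nat) :
    (0 < k <= N)%N -> (0 < l <= k)%N ->
  \sum_(i < N) sin ((2 * i.+1%:R - 1) * k%:R * pi / (2 * N%:R)) *
               sin ((2 * i.+1%:R - 1) * l%:R * pi / (2 * N%:R)) =
  (if k == l then if k == N then N%:R else N%:R / 2 else 0) :> R.
Proof.
move=> /andP[k0 kN] /andP[l0 lk].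
have N0 : N%:R != 0 :> R by rewrite pnatr_eq0; lia.
pose C m : R := \sum_(i < N) cos ((2 * i.+1%:R - 1) * (m%:R * pi / (2 * N%:R))).
have C0 : C 0%N = N%:R.
  rewrite /C (eq_bigr (fun=> 1)); last by move=> i _; rewrite !mul0r mulr0 cos0.
  by rewrite sumr_const card_ord.
transitivity ((C (k - l)%N - C (k + l)%N) / 2).
  rewrite /C -sumrB mulr_suml; apply: eq_bigr => i _.
  rewrite mul_sin_sin natrB // natrD.
  by congr ((cos _ - cos _) / 2); field.
(* Off the diagonal [l < k <= N], so both [k - l] and [k + l] lie strictly between 0 and [2N]. *)
case: eqVneq => [kl|nkl]; last first.
  by rewrite /C !sum_cos_odd_eq0 ?subrr ?mul0r //; lia.
rewrite -kl subnn C0; case: eqVneq => [->|kN'].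
  (* At frequency [2N] every cosine is that of an odd multiple of [pi], so the second sum adds a
     further [N] and doubles the last diagonal entry. *)
  suff -> : C (N + N)%N = - N%:R by field.
  rewrite /C (eq_bigr (fun=> -1)).
    by rewrite sumr_const card_ord mulNrn.
  by move=> i _; rewrite -[RHS](cos_oddpi R i); congr cos; rewrite natrD; field.
by rewrite [C (k + k)%N]sum_cos_odd_eq0 ?subr0 //; lia.
Qed.

Theorem proposition14 (R : realType) (N : nat) (hN : (1 <= N)%N) :
  Dmx R N = Smx R N *m Sigmamx R N /\
  (Smx R N)^T *m Smx R N =
    diag_mx (\row_(k < N) (if k.+1 == N then N%:R else N%:R / 2)).
Proof.
have N0 : N%:R != 0 :> R by rewrite pnatr_eq0 -lt0n.
split; apply/matrixP => i k.
  rewrite mul_mx_diag !mxE /segment /= Rintegral_deriv ?node_decreasing //.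
  rewrite /node !chebyshev_cos (mulrCA (sin _)) mul_sin_sin (mulrC 2) divfK //.
  by congr (cos _ - cos _); field.
rewrite !mxE; under eq_bigr do rewrite !mxE.
(* Above the diagonal the two sines are swapped to put the larger index first. *)
have [ki|ik] := leqP k i.
  by rewrite gram_sin_odd ?ltnS //= eqSS mulrb.
under eq_bigr do rewrite mulrC.
rewrite gram_sin_odd ?ltnS ?(ltnW ik) //= eqSS gtn_eqF //.
by rewrite mulrb -val_eqE ltn_eqF.
Qed.
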